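(* Let $r\geq 3$ be an integer. Then for all sufficiently large $n$, \[ ex(n,K_r,B_{r,0})=\mathcal{N}(K_{r-1},T_{r-1}(n-1)), \] and, up to isomorphism, $K_1\vee T_{r-1}(n-1)$ is the unique $B_{r,0}$-free graph on $n$ vertices attaining this maximum number of copies of $K_r$.
   Context: $B_{r,0}$ denotes the graph consisting of two vertex-disjoint copies of $K_r$. A graph is $F$-free if it contains no subgraph isomorphic to $F$. For graphs $T,F$, $ex(n,T,F)$ denotes the maximum number of copies of $T$ in an $F$-free graph on $n$ vertices, and $\mathcal{N}(T,G)$ denotes the number of copies of $T$ in the graph $G$. $T_r(m)$ denotes the $r$-partite Turán graph on $m$ vertices, i.e. the complete $r$-partite graph on $m$ vertices whose part sizes differ by at most one. The join $G_1\vee G_2$ is the disjoint union of $G_1$ and $G_2$ together with all edges between $V(G_1)$ and $V(G_2)$. *)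

(* Defs.v *)
From mathcomp Require Import all_boot.

Set Implicit Arguments.
Unset Strict Implicit.
Unset Printing Implicit Defensive.

(** Finite simple graphs. *)
Record sgraph := SGraph {
  vertex :> finType;
  adj : rel vertex;
  adj_sym : symmetric adj;
  adj_irr : irreflexive adj }.

Arguments adj {s} x y.

Definition isomorphic (G H : sgraph) : Prop :=
  exists2 f : G -> H, bijective f & {mono f : x y / adj x y}.

(** Injective homomorphisms: the image need not be an induced subgraph. *)
Definition embedding (H G : sgraph) (f : {ffun H -> G}) : bool :=
  injectiveb f && [forall x, forall y, adj x y ==> adj (f x) (f y)].

Definition free (F G : sgraph) : bool :=
  ~~ [exists f : {ffun F -> G}, embedding f].

(** The image of [H] as a subgraph of [G]: its vertex set and its edge set. *)
Definition image_subgraph (H G : sgraph) (f : {ffun H -> G}) :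
    {set G} * {set {set G}} :=
  ([set f x | x : H],
   [set e : {set G} | [exists x, exists y, adj x y && (e == [set f x; f y])]]).

(** Copies are counted as subgraphs, so embeddings with the same image (which
    differ by an automorphism of [H]) are identified. *)
Definition copies (H G : sgraph) : nat :=
  #|[set image_subgraph f | f : {ffun H -> G} & embedding f]|.

(** The graph on ['I_n] with edge set [E]; members of [E] that are not
    two-element sets are ignored, so every simple graph on ['I_n] is obtained. *)
Section GraphOfEdges.
Variables (n : nat) (E : {set {set 'I_n}}).

Definition edges_adj : rel 'I_n := fun x y => (x != y) && ([set x; y] \in E).

Lemma edges_adj_sym : symmetric edges_adj.
Proof. by move=> x y; rewrite /edges_adj eq_sym setUC. Qed.

Lemma edges_adj_irr : irreflexive edges_adj.
Proof. by move=> x; rewrite /edges_adj eqxx. Qed.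

Definition graph_of_edges : sgraph := SGraph edges_adj_sym edges_adj_irr.

End GraphOfEdges.

Definition ex_copies (n : nat) (H F : sgraph) : nat :=
  \max_(E : {set {set 'I_n}} | free F (graph_of_edges E))
    copies H (graph_of_edges E).

Section CompleteMultipartite.
Variables (V : finType) (I : eqType) (part : V -> I).

Definition multipartite_adj : rel V := fun x y => part x != part y.

Lemma multipartite_adj_sym : symmetric multipartite_adj.
Proof. by move=> x y; rewrite /multipartite_adj eq_sym. Qed.

Lemma multipartite_adj_irr : irreflexive multipartite_adj.
Proof. by move=> x; rewrite /multipartite_adj eqxx. Qed.

Definition complete_multipartite : sgraph :=
  SGraph multipartite_adj_sym multipartite_adj_irr.

End CompleteMultipartite.

Definition complete (r : nat) : sgraph :=
  complete_multipartite (fun x : 'I_r => x).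

(** The parts are the residue classes modulo [r] (for [0 < r]), whose sizes
    differ by at most one. *)
Definition turan (r m : nat) : sgraph :=
  complete_multipartite (fun x : 'I_m => x %% r).

Section UnionJoin.
Variables G H : sgraph.

(** [cross] tells whether vertices of [G] are adjacent to vertices of [H]. *)
Definition sum_adj (cross : bool) : rel (G + H)%type := fun u v =>
  match u, v with
  | inl x, inl y => adj x y
  | inr x, inr y => adj x y
  | _, _ => cross
  end.

Lemma sum_adj_sym cross : symmetric (sum_adj cross).
Proof. by move=> [x|x] [y|y] //=; rewrite adj_sym. Qed.

Lemma sum_adj_irr cross : irreflexive (sum_adj cross).
Proof. by move=> [x|x] /=; rewrite adj_irr. Qed.

Definition disjoint_union : sgraph :=
  SGraph (sum_adj_sym false) (sum_adj_irr false).

Definition join : sgraph := SGraph (sum_adj_sym true) (sum_adj_irr true).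

End UnionJoin.

(** Usually written [B_{r,0}]. *)
Definition B0 (r : nat) : sgraph := disjoint_union (complete r) (complete r).

(* Main.v *)
Require Import Defs.
From mathcomp Require Import all_boot zify.

(** In a [B_{r,0}]-free graph the [r]-cliques pairwise intersect. If they have no
    common vertex, there are only [O(n^(r-2))] of them, fewer than in the
    extremal graph, which has order [n^(r-1)] of them. If they share a vertex [v],
    then [G - v] is [K_r]-free and the [r]-cliques of [G] correspond to
    [r-1]-cliques of [G - v], so Zykov's theorem bounds their number; equality
    forces [G - v] to be a Turan graph all of whose vertices are joined to [v]. *)

Set Implicit Arguments.
Unset Strict Implicit.
Unset Printing Implicit Defensive.

(** * Bijections with prescribed fibers, and balanced products *)

(** The uniqueness claim shapes the proof: the counting has to leave an isomorphism behind. Extremal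
    graphs are therefore described by labellings of the vertices such that two vertices are adjacent
    exactly when their labels differ. Two graphs labelled in this way are isomorphic as soon as
    corresponding labels are used equally often, so only cardinalities need to be matched. Zykov's
    theorem is stated with the product of the part sizes instead of the Turan count, because its
    induction passes to neighbourhoods whose sizes are not controlled. That product is maximised
    afterwards, for a fixed sum of the sizes. Both steps carry their equality cases along. *)

Lemma fiber_injection (V W : finType) (T : eqType) (f : V -> T) (g : W -> T) :
  (forall t, #|[set x | f x == t]| <= #|[set y | g y == t]|) ->
  exists2 h : V -> W, injective h & forall x, g (h x) = f x.
Proof.
(* [nth] needs an element of [W] as default; if there is none, the fiber bound makes [V] empty as
   well. Otherwise [h] sends the k-th element of each fiber of [f] to the k-th element of the same
   fiber of [g]. *)
move=> le_fg; case: (pickP (@predT W)) => [w0 _|W0]; last first.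
  have V0 (x : V) : False.
    have := le_fg (f x); rewrite [X in _ <= X]eq_card0 => [|w]; last by have:= W0 w.
    by rewrite leqn0 cards_eq0 => /eqP/setP/(_ x); rewrite !inE eqxx.
  by exists (fun x => False_rect W (V0 x)) => x; case: (V0 x).
pose F t := [set x | f x == t]; pose H t := [set y | g y == t].
pose h x := nth w0 (enum (H (f x))) (index x (enum (F (f x)))).
have lt_h x : index x (enum (F (f x))) < size (enum (H (f x))).
  by rewrite -cardE (leq_trans _ (le_fg _)) // cardE index_mem mem_enum inE.
have gh x : g (h x) = f x.
  by have := mem_nth w0 (lt_h x); rewrite mem_enum inE => /eqP.
exists h => // x y eq_h.
have eq_f : f x = f y by rewrite -!gh eq_h.
have lt_y := lt_h y; have lt_x := lt_h x.
move: eq_h; rewrite /h -eq_f => /eqP.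
rewrite nth_uniq ?enum_uniq -?eq_f //; last by rewrite eq_f -eq_f in lt_y *.
have xF: x \in enum (F (f x)) by rewrite mem_enum inE.
have yF: y \in enum (F (f x)) by rewrite mem_enum inE eq_f.
by move=> /eqP E; rewrite -(nth_index x xF) -(nth_index x yF) E.
Qed.

(** Turns equal counts into bijections. It is applied to vertices with their part labels, and to
    part labels with their part sizes. *)
Lemma fiber_bijection (V W : finType) (T : eqType) (f : V -> T) (g : W -> T) :
  (forall t, #|[set x | f x == t]| = #|[set y | g y == t]|) ->
  exists2 h : V -> W, bijective h & forall x, g (h x) = f x.
Proof.
move=> eq_fg.
have [h h_inj gh] : exists2 h : V -> W, injective h & forall x, g (h x) = f x.
  by apply: fiber_injection => t; rewrite eq_fg.
have [k k_inj _] : exists2 k : W -> V, injective k & forall x, f (k x) = g x.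
  by apply: fiber_injection => t; rewrite eq_fg.
by exists h => //; apply: inj_card_bij => //; apply: leq_card k_inj.
Qed.

Definition balanced (s q : nat) (a : 'I_s -> nat) :=
  [forall i, (a i == q) || (a i == q.+1)].

(* [a |-> a * q ^ a / q.+1 ^ a] peaks exactly at [q] and [q.+1]; the factors
   below clear the denominators. *)
Lemma balanced_weight (q a : nat) : 0 < q ->
  a * q ^ a * q.+1 ^ q <= q ^ q.+1 * q.+1 ^ a
    ?= iff (a == q) || (a == q.+1).
Proof.
move=> q0.
(* Bernoulli's inequality [1 + k/q <= (1 + 1/q)^k], for the case [a = q + k]. *)
have up k : (q + k) * q ^ k <= q * q.+1 ^ k ?= iff (k <= 1).
  elim: k => [|[|k] IH]; first by split; rewrite ?addn0 ?eqxx.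
    by split; rewrite ?expn1 addn1 mulnC ?eqxx.
  have lt : (q + k.+2) * q ^ k.+2 < q * q.+1 ^ k.+2.
    have le := IH.1; rewrite (expnS q k.+1) (expnS q.+1 k.+1).
    have p0 : 0 < q ^ k.+1 by rewrite expn_gt0 q0.
    have: (q + k.+2) * (q * q ^ k.+1) < q.+1 * ((q + k.+1) * q ^ k.+1) by nia.
    by move=> /leq_trans; apply; rewrite [leqRHS]mulnCA leq_mul2l le orbT.
  by split; [exact: ltnW | rewrite ltn_eqF].
(* The mirror image [1 - k/q < (1 + 1/q)^(-k)], for the case [a = q - k]. *)
have down k : 0 < k -> k <= q -> (q - k) * q.+1 ^ k < q * q ^ k.
  elim: k => // -[_ _ lt|k IH _ lt]; first by rewrite !expn1; nia.
  have le := IH isT (ltnW lt).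
  rewrite (expnS q k.+1) (expnS q.+1 k.+1).
  have p0 : 0 < q.+1 ^ k.+1 by rewrite expn_gt0.
  apply: (@leq_ltn_trans (q * ((q - k.+1) * q.+1 ^ k.+1))).
    have h : (q - k.+2) * q.+1 <= q * (q - k.+1) by nia.
    by rewrite !mulnA leq_mul2r h orbT.
  by rewrite ltn_mul2l q0.
have e0 n : 0 < q ^ n by rewrite expn_gt0 q0.
have e1 n : 0 < q.+1 ^ n by rewrite expn_gt0.
case: (leqP q a) => [le|lt].
  have [k ->] : exists k, a = q + k by exists (a - q); lia.
  have -> : (q + k == q) || (q + k == q.+1) = (k <= 1) by lia.
  have -> : (q + k) * q ^ (q + k) * q.+1 ^ q = (q + k) * q ^ k * (q ^ q * q.+1 ^ q).
    by rewrite expnD; nia.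
  have -> : q ^ q.+1 * q.+1 ^ (q + k) = q * q.+1 ^ k * (q ^ q * q.+1 ^ q).
    by rewrite expnD expnS; nia.
  have := up k; rewrite /leqif leq_mul2r eqn_mul2r muln_eq0.
  by rewrite !expn_eq0 /=; case: (q) q0 => //= q' _ [-> ->]; rewrite orbT.
have [k [k0 [kq ->]]] : exists k, 0 < k /\ k <= q /\ a = q - k.
  by exists (q - a); lia.
have -> : (q - k == q) || (q - k == q.+1) = false by lia.
have eqk n : n ^ q = n ^ (q - k) * n ^ k by rewrite -expnD subnK.
have lt' : (q - k) * q ^ (q - k) * q.+1 ^ q < q ^ q.+1 * q.+1 ^ (q - k).
  have -> : (q - k) * q ^ (q - k) * q.+1 ^ q
     = (q - k) * q.+1 ^ k * (q ^ (q - k) * q.+1 ^ (q - k)).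
    by rewrite (eqk q.+1); nia.
  have -> : q ^ q.+1 * q.+1 ^ (q - k) = q * q ^ k * (q ^ (q - k) * q.+1 ^ (q - k)).
    by rewrite expnS (eqk q); nia.
  by rewrite ltn_mul2r muln_gt0 e0 e1 down.
by split; [exact: ltnW | rewrite ltn_eqF].
Qed.

(** When [balanced_weight] is multiplied over all indices, the extra factors depend on [a] only
    through its sum. So [a] and [b] have the same upper bound, and [b] attains it. The factors [U]
    are positive, so a single unbalanced [a i] makes the inequality strict. *)
Lemma prod_balanced (s q : nat) (a b : 'I_s -> nat) :
  0 < q -> balanced q b -> \sum_i a i = \sum_i b i ->
  \prod_i a i <= \prod_i b i ?= iff balanced q a.
Proof.
move=> q0 bal_b eq_sum.
pose L (c : 'I_s -> nat) i := c i * q ^ c i * q.+1 ^ q.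
pose U (c : 'I_s -> nat) i := q ^ q.+1 * q.+1 ^ c i.
have prodL c : \prod_i L c i = \prod_i c i * (q ^ (\sum_i c i) * (q.+1 ^ q) ^ s).
  by rewrite !big_split /= prod_nat_const card_ord expn_sum mulnA.
have prodU c : \prod_i U c i = (q ^ q.+1) ^ s * q.+1 ^ (\sum_i c i).
  by rewrite !big_split /= prod_nat_const card_ord expn_sum.
have U0 c i : 0 < U c i by rewrite muln_gt0 !expn_gt0 q0.
have LUeq c : balanced q c -> \prod_i L c i = \prod_i U c i.
  move=> /forallP bal; apply: eq_bigr => i _; apply/eqP.
  by rewrite (balanced_weight (c i) q0).2.
have LU c i : L c i <= U c i by exact: (balanced_weight _ q0).1.
have LUlt c : ~~ balanced q c -> \prod_i L c i < \prod_i U c i.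
  case/forallPn => i nb; rewrite (bigD1 i) //= [ltnRHS](bigD1 i) //=.
  have lt : L c i < U c i by rewrite ltn_neqAle (balanced_weight _ q0).1 (balanced_weight _ q0).2 nb.
  apply: (@leq_ltn_trans (L c i * \prod_(j < s | j != i) U c j)).
    by rewrite leq_mul2l leq_prod ?orbT.
  by rewrite ltn_mul2r lt prodn_gt0.
have p0 : 0 < q ^ (\sum_i b i) * (q.+1 ^ q) ^ s.
  by rewrite muln_gt0 !expn_gt0 q0.
have key : \prod_i U a i = \prod_i L b i by rewrite LUeq // !prodU eq_sum.
have [bal|nb] := boolP (balanced q a).
  have := LUeq a bal; rewrite key !prodL eq_sum => /eqP.
  by rewrite eqn_pmul2r // => /eqP ->; split; rewrite ?eqxx.
have := LUlt a nb; rewrite key !prodL eq_sum ltn_pmul2r // => lt.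
by split; [exact: ltnW | rewrite ltn_eqF].
Qed.

(** The sum exceeds [s * q] by the number of values [q.+1], so it determines how often each of the
    two possible values occurs. *)
Lemma balanced_fibers (s q : nat) (a b : 'I_s -> nat) (t : nat) :
  balanced q a -> balanced q b -> \sum_i a i = \sum_i b i ->
  #|[set i | a i == t]| = #|[set i | b i == t]|.
Proof.
have big (c : 'I_s -> nat) : balanced q c -> \sum_i c i = s * q + #|[set i | c i == q.+1]|.
  move=> /forallP bal.
  have -> : \sum_i c i = \sum_(i < s) (q + (c i == q.+1)).
    by apply: eq_bigr => i _; have /orP[/eqP->|/eqP->] := bal i; lia.
  rewrite big_split /= sum_nat_const card_ord -sum1dep_card [in RHS]big_mkcond.
  by congr (_ + _); apply: eq_bigr => i _; case: eqP.
have small (c : 'I_s -> nat) : balanced q c -> #|[set i | c i == q]| + #|[set i | c i == q.+1]| = s.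
  move=> /forallP bal; apply: etrans (card_ord s); rewrite -(cardsC [set i | c i == q]).
  congr (_ + _); apply: eq_card => i; rewrite !inE.
  by have /orP[/eqP->|/eqP->] := bal i; lia.
have none (c : 'I_s -> nat) : balanced q c -> t != q -> t != q.+1 -> #|[set i | c i == t]| = 0.
  move=> /forallP bal tq tq1; apply: eq_card0 => i; rewrite !inE.
  by have /orP[/eqP->|/eqP->] := bal i; lia.
move=> bal_a bal_b eq_sum.
have := big a bal_a; have := big b bal_b; have := small a bal_a; have := small b bal_b.
have := none a bal_a; have := none b bal_b.
case: (eqVneq t q) => [->|tq]; first lia.
case: (eqVneq t q.+1) => [->|tq1]; first lia.
by move=> -> // ->.
Qed.

Lemma card_residue (s m i : nat) : i < s ->
  #|[set x : 'I_m | x %% s == i]| = m %/ s + (i < m %% s).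
Proof.
move=> lt_is.
have -> : #|[set x : 'I_m | x %% s == i]| = count (fun x => x %% s == i) (iota 0 m).
  rewrite -val_enum_ord count_map cardE enumT -enumT -size_filter.
  by congr size; rewrite {1}/enum_mem -enumT; apply: eq_filter => x; rewrite /= inE.
(* Each full block of [s] consecutive integers contains exactly one from the class of [i]; the last,
   partial block contains one iff [i < m %% s]. *)
rewrite {1}(divn_eq m s); elim: (m %/ s) => [|q IH].
  rewrite mul0n !add0n.
  have lt_ms : m %% s < s by rewrite ltn_mod; lia.
  rewrite (@eq_in_count _ _ (pred1 i)); last first.
    by move=> x; rewrite mem_iota /= => lt; rewrite modn_small //; lia.
  by rewrite count_uniq_mem ?iota_uniq // mem_iota.
rewrite mulSn -addnA iotaD count_cat add0n.
rewrite (@eq_in_count _ _ (pred1 i)) ; last first.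
  by move=> x; rewrite mem_iota /= => lt; rewrite modn_small //; lia.
rewrite count_uniq_mem ?iota_uniq // mem_iota /= add0n lt_is.
rewrite -[X in iota X _](addn0 s) iotaDl count_map.
rewrite (@eq_count _ _ (fun x => x %% s == i)) ?IH //.
by move=> x /=; rewrite modnDl.
Qed.

Lemma balanced_residue (s m : nat) :
  balanced (m %/ s) (fun i : 'I_s => #|[set x : 'I_m | x %% s == i]|).
Proof.
apply/forallP => i; rewrite card_residue //.
by case: (i < _); rewrite ?addn0 ?addn1 eqxx ?orbT.
Qed.

Lemma sum_fibers (V : finType) (A : {set V}) (p : V -> nat) (s : nat) :
  {in A, forall x, p x < s} ->
  \sum_(i < s) #|[set x in A | p x == i]| = #|A|.
Proof.
move=> lt_p.
under eq_bigr do rewrite -sum1dep_card big_mkcondr /=.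
rewrite exchange_big -sum1_card; apply: eq_bigr => x xA /=.
by rewrite (bigD1 (Ordinal (lt_p x xA))) //= eqxx big1 // => i; rewrite -val_eqE /= eq_sym => /negPf->.
Qed.

(** * Cliques and Zykov's theorem *)

Definition clique (G : sgraph) (S : {set G}) : bool :=
  [forall x in S, forall y in S, (x != y) ==> adj x y].

(** Relative to a vertex set [A], so that passing to a neighbourhood or deleting a vertex does not
    change the ambient graph. *)
Definition cliques (G : sgraph) (A : {set G}) (k : nat) : {set {set G}} :=
  [set S : {set G} | [&& S \subset A, clique S & #|S| == k]].

Definition link (G : sgraph) (A : {set G}) (x : G) : {set G} :=
  [set y in A | adj x y].

(** Labels live in [nat] rather than in ['I_s], so that a further part can take the label [s]
    without retyping the others. *)
Definition fiber (V : finType) (A : {set V}) (p : V -> nat) (i : nat) : {set V} :=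
  [set x in A | p x == i].

Section Cliques.
Variable G : sgraph.
Implicit Types (A B S T : {set G}) (x y : G) (k : nat).

Lemma cliqueP S : reflect {in S &, forall x y, x != y -> adj x y} (clique S).
Proof.
apply: (iffP forall_inP) => [h x y xS yS xy | h x xS].
  by have /forall_inP/(_ y yS)/implyP := h x xS; apply.
by apply/forall_inP => y yS; apply/implyP; apply: h.
Qed.

Lemma sub_clique S T : T \subset S -> clique S -> clique T.
Proof.
by move=> /subsetP TS /cliqueP cS; apply/cliqueP => x y /TS xS /TS yS; apply: cS.
Qed.

Lemma cliqueU1 S x : clique S -> {in S, forall y, adj x y} -> clique (x |: S).
Proof.
move=> /cliqueP cS adjx; apply/cliqueP => y z.
rewrite !inE => /predU1P[->|yS] /predU1P[->|zS] yz; first by rewrite eqxx in yz.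
- exact: adjx.
- by rewrite adj_sym adjx.
- exact: cS.
Qed.

Lemma sub_cliques A B k : A \subset B -> cliques A k \subset cliques B k.
Proof.
move=> AB; apply/subsetP => S; rewrite !inE => /and3P[SA -> ->].
by rewrite (subset_trans SA AB).
Qed.

Lemma cliquesU1 A S x k : x \in A -> S \in cliques (link A x) k ->
  x |: S \in cliques A k.+1.
Proof.
move=> xA; rewrite !inE => /and3P[/subsetP SL cS /eqP cardS].
have xS : x \notin S by apply/negP => /SL; rewrite inE adj_irr andbF.
rewrite cardsU1 xS cardS add1n eqxx andbT cliqueU1 //; last first.
  by move=> y /SL; rewrite inE => /andP[].
rewrite andbT; apply/subsetP => y; rewrite !inE => /predU1P[->//|/SL].
by rewrite inE => /andP[].
Qed.

Lemma card_cliques_at A x k : x \in A ->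
  #|[set S in cliques A k.+1 | x \in S]| = #|cliques (link A x) k|.
Proof.
move=> xA.
have notin S : S \in cliques (link A x) k -> x \notin S.
  by rewrite inE => /and3P[/subsetP SL _ _]; apply/negP => /SL; rewrite inE adj_irr andbF.
rewrite -(@card_in_imset _ _ (fun S => x |: S) (mem (cliques (link A x) k))); last first.
  by move=> S T /notin xS /notin xT eqST; rewrite -(setU1K xS) eqST setU1K.
apply: eq_card => S; apply/idP/imsetP => [|[T Tin ->]]; last first.
  by rewrite inE cliquesU1 // setU11.
rewrite !inE => /andP[/and3P[/subsetP SA cS /eqP cardS] xS].
exists (S :\ x); last by rewrite setD1K.
rewrite inE (sub_clique (subsetDl S [set x]) cS) /=; apply/andP; split.
  apply/subsetP => y; rewrite !inE => /andP[yx yS]; rewrite SA //=.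
  by have /cliqueP := cS; apply; rewrite // eq_sym.
by have := cardsD1 x S; rewrite xS cardS add1n => -[->].
Qed.

Lemma cliques0 A : #|cliques A 0| = 1.
Proof.
rewrite -(cards1 (set0 : {set G})); apply: eq_card => S; rewrite !inE.
apply/and3P/eqP => [[_ _]|->]; first by rewrite cards_eq0 => /eqP.
by rewrite sub0set cards0; split => //; apply/cliqueP => x y; rewrite inE.
Qed.

End Cliques.

(** * Complete multipartite graphs given by labels *)

Section Multipartite.
Variables (G : sgraph) (A : {set G}) (p : G -> nat) (s : nat).
Hypothesis multi : {in A &, forall x y, adj x y = (p x != p y)}.

Lemma transversal_clique (f : 'I_s -> G) :
  (forall i, f i \in fiber A p i) -> f @: setT \in cliques A s.
Proof.
move=> fP.
have fA i : f i \in A by have := fP i; rewrite inE => /andP[].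
have pf i : p (f i) = i by have := fP i; rewrite inE => /andP[_ /eqP].
rewrite inE; apply/and3P; split.
- by apply/subsetP => x /imsetP[i _ ->].
- apply/cliqueP => x y /imsetP[i _ ->] /imsetP[j _ ->] ij.
  by rewrite multi // !pf; apply: contra_neq ij => /val_inj->.
- by rewrite card_imset ?cardsT ?card_ord // => i j eqf; apply: val_inj; rewrite /= -!pf eqf.
Qed.

(** Choosing one vertex per part gives a clique, and the labels recover the choice from the
    clique. *)
Lemma prod_fibers_le_cliques : \prod_(i < s) #|fiber A p i| <= #|cliques A s|.
Proof.
pose F (i : 'I_s) := mem (fiber A p i).
have -> : \prod_(i < s) #|fiber A p i| = #|[set f in family F]|.
  by rewrite cardsE card_family foldrE big_map big_enum.
rewrite -(@card_in_imset _ _ (fun f : {ffun 'I_s -> G} => f @: setT)).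
  apply/subset_leq_card/subsetP => S /imsetP[f]; rewrite inE => /familyP fP ->.
  exact: transversal_clique.
move=> f g; rewrite !inE => /familyP fP /familyP gP eqfg.
apply/ffunP => i.
have : f i \in g @: setT by rewrite -eqfg imset_f.
case/imsetP => j _ eqf; have := fP i; have := gP j.
by rewrite eqf !inE => /andP[_ /eqP->] /andP[_ /eqP/val_inj ->].
Qed.

(** Passes from cliques to single vertices: a vertex adjacent to all of every [s]-clique in [A] is
    then adjacent to all of [A]. *)
Lemma clique_through x : x \in A -> (forall y, y \in A -> p y < s) ->
  (forall i, i < s -> 0 < #|fiber A p i|) ->
  exists2 S, S \in cliques A s & x \in S.
Proof.
move=> xA lt_p fib.
have [f fP] : exists f : forall i : 'I_s, G,
    forall i, f i \in fiber A p i /\ (p x = i -> f i = x).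
  apply: (@fin_all_exists 'I_s (fun=> vertex G)
      (fun i y => y \in fiber A p i /\ (p x = i -> y = x))).
  move=> i; have [pxi|pxi] := eqVneq (p x) (nat_of_ord i).
    by exists x; rewrite inE xA pxi eqxx.
  have := fib i (ltn_ord i); rewrite card_gt0 => /set0Pn[y yF].
  by exists y; split => // E; rewrite E eqxx in pxi.
exists (f @: setT); first by apply: transversal_clique => i; case: (fP i).
apply/imsetP; exists (Ordinal (lt_p x xA)) => //.
by case: (fP (Ordinal (lt_p x xA))) => _ ->.
Qed.

Lemma clique_part_inj (S : {set G}) : S \subset A -> clique S -> {in S &, injective p}.
Proof.
move=> /subsetP SA /cliqueP cS x y xS yS; apply: contra_eq => xy.
by rewrite -multi ?SA // cS.
Qed.

Lemma multipartite_clique_size (S : {set G}) : (forall y, y \in A -> p y < s) ->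
  S \subset A -> clique S -> #|S| <= s.
Proof.
case: s => [|s'] lt_p SA cS.
  have -> : S = set0 by apply/eqP; rewrite -subset0; apply/subsetP => x /(subsetP SA)/lt_p.
  by rewrite cards0.
rewrite -(@card_in_imset _ _ (fun x => inord (p x) : 'I_s'.+1)).
  by rewrite (leq_trans (max_card _)) // card_ord.
move=> x y xS yS /(congr1 val) /=; rewrite !inordK ?lt_p ?(subsetP SA) //.
exact: clique_part_inj cS _ _ xS yS.
Qed.

End Multipartite.

(* Induction on [s]: let [v] lie in the most [s.+1]-cliques and [B] be its
   neighbourhood in [A]. Every [s.+1]-clique leaves [B], because [B] contains no
   [s.+1]-clique, so there are at most [#|A :\: B| * #|cliques B s|] of them. *)
Theorem zykov (G : sgraph) (s : nat) (A : {set G}) :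
  cliques A s.+1 = set0 ->
  exists p : G -> nat,
    [/\ {in A, forall x, p x < s},
        #|cliques A s| <= \prod_(i < s) #|fiber A p i|
      & #|cliques A s| = \prod_(i < s) #|fiber A p i| -> 0 < #|cliques A s| ->
        {in A &, forall x y, adj x y = (p x != p y)}].
Proof.
elim: s A => [|s IH] A noK.
  have A0 x : x \notin A.
    apply/negP => xA; have : [set x] \in cliques A 1.
      rewrite inE sub1set xA cards1 /= andbT; apply/cliqueP => y z.
      by rewrite !inE => /eqP-> /eqP->; rewrite eqxx.
    by rewrite noK inE.
  exists (fun=> 0); split; rewrite ?cliques0 ?big_ord0 //.
    by move=> x; rewrite (negPf (A0 x)).
  by move=> _ _ x y; rewrite (negPf (A0 x)).
have [->|/set0Pn[v0 v0A]] := eqVneq A set0.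
  exists (fun=> 0); split => //; last by move=> _ _ x y; rewrite inE.
  rewrite (_ : cliques _ _ = set0) ?cards0 //; apply/setP => S; rewrite !inE.
  rewrite subset0; apply/negP => /and3P[/eqP-> _]; by rewrite cards0.
pose d x := #|cliques (link A x) s|.
case: (@arg_maxnP _ v0 (mem A) d v0A) => v vA max_v.
pose B := link A v; pose D := A :\: B.
have BA : B \subset A by apply/subsetP => x; rewrite inE => /andP[].
have noKB : cliques B s.+1 = set0.
  apply/eqP; rewrite -subset0; apply/subsetP => S /(cliquesU1 vA).
  by rewrite noK inE.
have [p [lt_p le_p eq_p]] := IH B noKB.
pose p' x := if x \in B then p x else s.
have p'B x : x \in B -> p' x = p x by rewrite /p' => ->.
have p'D x : x \in D -> p' x = s by rewrite inE /p' => /andP[/negPf->].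
have fibB (i : nat) : i < s -> fiber A p' i = fiber B p i.
  move=> lt; apply/setP => x; rewrite [LHS]inE [RHS]inE /p'.
  case: (boolP (x \in B)) => [xB|xB]; first by rewrite (subsetP BA).
  by rewrite gtn_eqF ?andbF.
have fibD : fiber A p' s = D.
  apply/setP => x; rewrite [in RHS]inE inE /p'; case: ifP => xB; rewrite ?eqxx ?andbT //.
  by have := lt_p x xB; case: eqP => [->|]; rewrite ?ltnn ?andbF.
have prod_fib : \prod_(i < s.+1) #|fiber A p' i| = \prod_(i < s) #|fiber B p i| * #|D|.
  rewrite big_ord_recr /= fibD; congr (_ * _); apply: eq_bigr => i _.
  by rewrite fibB.
have meetD S : S \in cliques A s.+1 -> 0 < #|S :&: D|.
  move=> SK; rewrite lt0n; apply/negP => /eqP/cards0_eq SD.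
  have : S \in cliques B s.+1.
    move: SK; rewrite !inE => /and3P[/subsetP SA -> ->]; rewrite !andbT.
    apply/subsetP => x xS; have := in_set0 x; rewrite -SD !inE xS SA //=.
    by rewrite andbT => /negbFE.
  by rewrite noKB inE.
(* Double counting of the pairs [(S, x)] with [x] in [S :&: D]; by [card_cliques_at], exactly [d x]
   of the cliques contain [x]. *)
have double : \sum_(S in cliques A s.+1) #|S :&: D| = \sum_(x in D) d x.
  under eq_bigr do rewrite -sum1_card.
  rewrite (exchange_big_dep (mem D)) /=; last by move=> S x _; rewrite inE => /andP[].
  apply: eq_bigr => x xD; rewrite /d -card_cliques_at; last by move: xD; rewrite inE => /andP[].
  rewrite -sum1_card; apply: eq_bigl => S; rewrite !inE.
  by move: xD; rewrite !inE => ->; rewrite andbT.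
(* [leqif] records when equality holds: in [le1] if every clique meets [D] exactly once, in [le2] if
   every vertex of [D] lies in as many cliques as [v]. *)
have le1 := @leqif_sum _ (mem (cliques A s.+1)) (fun S => 1 == #|S :&: D|)
  (fun=> 1) (fun S => #|S :&: D|)
  (fun S SK => conj (meetD S SK) (erefl _)).
have DA x : x \in D -> x \in A by rewrite inE => /andP[].
have le2 := @leqif_sum _ (mem D) (fun x => d x == d v) d (fun=> d v)
  (fun x xD => conj (max_v x (DA x xD)) (erefl _)).
rewrite /= sum1_card double in le1; rewrite /= sum_nat_const in le2.
have le3 : #|cliques A s.+1| <= #|D| * d v := leq_trans le1.1 le2.1.
exists p'; split.
- move=> x xA; rewrite /p'; case: ifP => // xB; exact: ltnW (lt_p x xB).
- by rewrite prod_fib mulnC (leq_trans le3) // leq_mul2l le_p orbT.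
rewrite prod_fib => eqK posK.
have D0 : 0 < #|D| by move: posK; rewrite eqK muln_gt0 => /andP[].
have eqB : d v = \prod_(i < s) #|fiber B p i|.
  apply/eqP; rewrite eqn_leq le_p /= -(leq_pmul2r D0) -eqK mulnC; exact: le3.
have posB : 0 < d v by rewrite eqB; move: posK; rewrite eqK muln_gt0 => /andP[].
have multiB := eq_p eqB posB.
have eq3 : #|cliques A s.+1| = #|D| * d v by rewrite eqK mulnC eqB.
have eq1 : #|cliques A s.+1| == \sum_(x in D) d x.
  by rewrite eqn_leq le1.1 eq3 le2.1.
have eq2 : \sum_(x in D) d x == #|D| * d v by rewrite -(eqP eq1) eq3.
rewrite le1.2 in eq1; rewrite le2.2 in eq2.
have oneD S : S \in cliques A s.+1 -> #|S :&: D| = 1.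
  by move=> SK; have /forall_inP/(_ S SK)/eqP := eq1.
have degD x : x \in D -> d x = d v.
  by move=> xD; have /forall_inP/(_ x xD)/eqP := eq2.
(* For an [s]-clique [T] in the link of [x], the clique [x |: T] meets [D] in [x] alone, so [T] lies
   in [B]; equal cardinalities turn this inclusion into an equality. *)
have linkD x : x \in D -> cliques (link A x) s = cliques B s.
  move=> xD; apply/eqP; rewrite eqEcard -/(d v) -/(d x) degD // leqnn andbT.
  apply/subsetP => T TK; have := oneD _ (cliquesU1 (DA x xD) TK).
  move: TK; rewrite !inE => /and3P[/subsetP TL -> ->] /eqP; rewrite !andbT.
  case/cards1P => z Ez; have zx : x = z by apply/set1P; rewrite -Ez inE setU11.
  apply/subsetP => y yT; have := TL y yT; rewrite inE => /andP[yA xy].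
  apply/negPn/negP => yB; have : y \in [set z].
    by rewrite -Ez in_setI in_setU yT orbT in_setD yB yA.
  by rewrite inE -zx => /eqP yx; rewrite yx adj_irr in xy.
have fib0 (i : nat) : i < s -> 0 < #|fiber B p i|.
  move=> lt; move: posB; rewrite eqB (bigD1 (Ordinal lt)) //= muln_gt0.
  by case/andP.
have adjDB x y : x \in D -> y \in B -> adj x y.
  move=> xD yB; have [T TK yT] := clique_through multiB yB lt_p fib0.
  by move: TK; rewrite -(linkD x) // inE => /and3P[/subsetP/(_ y yT)]; rewrite inE => /andP[].
(* An edge inside [D] together with an [s]-clique of [B] would form a forbidden [s.+2]-clique. *)
have indep x y : x \in D -> y \in D -> adj x y = false.
  move=> xD yD; apply/negP => xy.
  have [T TK] : exists T, T \in cliques B s by apply/set0Pn; rewrite -card_gt0.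
  have TB : T \subset B by move: TK; rewrite inE => /and3P[].
  have : y |: T \in cliques (link A x) s.+1.
    apply: cliquesU1; first by rewrite inE DA.
    have := TK; rewrite !inE => /and3P[_ -> ->]; rewrite !andbT.
    apply/subsetP => z /(subsetP TB) zB.
    by rewrite !inE (subsetP BA) //= !adjDB.
  by move=> /(cliquesU1 (DA x xD)); rewrite noK inE.
have neq x : x \in B -> p x == s = false.
  by move=> xB; have := lt_p x xB; case: eqP => // ->; rewrite ltnn.
have dich x : x \in A -> (x \in B) || (x \in D).
  by move=> xA; rewrite in_setD xA andbT orbN.
move=> x y /dich/orP[xB|xD] /dich/orP[yB|yD].
- by rewrite !p'B ?multiB.
- by rewrite p'B ?p'D // (neq x) // adj_sym adjDB.
- by rewrite p'D ?p'B // eq_sym (neq y) // adjDB.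
- by rewrite !p'D ?eqxx ?indep.
Qed.

(** * Copies, cones over Turan graphs, and the extremal problem *)

Section Copies.
Variables (G : sgraph) (r : nat).

Lemma image_clique (f : 'I_r -> G) :
  (forall i j, i != j -> adj (f i) (f j)) ->
  [set f i | i : 'I_r] \in cliques setT r.
Proof.
move=> adjf; have f_inj : injective f.
  by move=> i j; apply: contra_eq => /adjf; apply: contraTneq => ->; rewrite adj_irr.
rewrite inE subsetT card_imset // card_ord eqxx andbT.
apply/cliqueP => x y /imsetP[i _ ->] /imsetP[j _ ->] ij.
by apply: adjf; apply: contra_neq ij => ->.
Qed.

Lemma clique_image (S : {set G}) : S \in cliques setT r ->
  exists2 f : 'I_r -> G, forall i j, i != j -> adj (f i) (f j)
                       & S = [set f i | i : 'I_r].
Proof.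
rewrite inE => /and3P[_ /cliqueP cS /eqP cardS].
pose e i := cast_ord (esym cardS) i.
have e_inj : injective e by exact: cast_ord_inj.
exists (fun i => enum_val (e i)) => [i j ij|].
  by apply: cS; rewrite ?enum_valP // (inj_eq enum_val_inj) (inj_eq e_inj).
apply/esym/eqP; rewrite eqEcard; apply/andP; split.
  by apply/subsetP => x /imsetP[i _ ->]; apply: enum_valP.
by rewrite card_imset ?card_ord ?cardS // => i j /enum_val_inj/e_inj.
Qed.

(** Injectivity is automatic: distinct vertices of a complete graph are adjacent, hence so are their
    images, and [adj] is irreflexive. *)
Lemma embedding_complete (f : {ffun complete r -> G}) :
  reflect (forall i j : 'I_r, i != j -> adj (f i) (f j)) (embedding f).
Proof.
apply: (iffP andP) => [[_ /forallP h] i j ij|h].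
  by have /forallP/(_ j)/implyP := h i; apply.
split; last by apply/forallP => i; apply/forallP => j; apply/implyP; apply: h.
apply/injectiveP => i j; apply: contra_eq => /h.
by apply: contraTneq => ->; rewrite adj_irr.
Qed.

(* A copy of a complete graph is determined by its vertex set. *)
Lemma copies_complete : copies (complete r) G = #|cliques [set: G] r|.
Proof.
pose P (S : {set G}) : {set {set G}} :=
  [set e | [exists x in S, exists y in S, (x != y) && (e == [set x; y])]].
have imgE (f : {ffun complete r -> G}) : embedding f ->
    image_subgraph f = ([set f i | i : 'I_r], P [set f i | i : 'I_r]).
  move=> /embedding_complete h; congr (_, _); apply/setP => e; rewrite !inE.
  apply/existsP/exists_inP => [[i /existsP[j /andP[ij /eqP->]]]|].
    exists (f i); rewrite ?imset_f //; apply/exists_inP; exists (f j); rewrite ?imset_f //.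
    rewrite eqxx andbT; apply: contraTneq (h i j ij) => ->; by rewrite adj_irr.
  case=> _ /imsetP[i _ ->] /exists_inP[_ /imsetP[j _ ->] /andP[fij /eqP->]].
  exists i; apply/existsP; exists j; rewrite eqxx andbT.
  by apply: contra_neq fij => ->.
rewrite /copies -(@card_imset _ _ (fun S => (S, P S))); last by move=> S T [].
apply: eq_card => u; apply/imsetP/imsetP.
  case=> f; rewrite inE => emb ->; rewrite imgE //.
  by eexists; last reflexivity; apply: image_clique; apply/embedding_complete.
case=> S /clique_image[f adjf ->] ->; exists [ffun i => f i].
  by rewrite inE; apply/embedding_complete => i j ij; rewrite !ffunE adjf.
have E : [set f i | i : 'I_r] = [set [ffun i => f i] i | i : 'I_r].
  by apply: eq_imset => i; rewrite ffunE.
rewrite imgE; first by rewrite -E.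
by apply/embedding_complete => i j ij; rewrite !ffunE adjf.
Qed.

(** Embeddings need not be induced, so edges of [G] between two disjoint cliques do not prevent them
    from forming a copy of [B0 r]. *)
Lemma free_B0P :
  reflect {in cliques [set: G] r &, forall S T, S :&: T != set0} (free (B0 r) G).
Proof.
apply: (iffP idP) => [fr S T SK TK|meet].
  apply: contraNneq fr => ST0; apply/existsP.
  have [f adjf Sf] := clique_image SK; have [g adjg Tg] := clique_image TK.
  have fg i j : f i <> g j.
    move=> E; have : f i \in S :&: T by rewrite inE {1}Sf {2}E Tg !imset_f.
    by rewrite ST0 inE.
  exists [ffun u => match u with inl i => f i | inr j => g j end].
  apply/andP; split; last first.
    apply/forallP => -[i|i]; apply/forallP => -[j|j]; apply/implyP => //= ij;
      rewrite !ffunE; [exact: adjf|exact: adjg].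
  apply/injectiveP => -[i|i] [j|j]; rewrite !ffunE => E; try congr (_ _).
  - by apply: contra_eq E => /adjf; apply: contraTneq => ->; rewrite adj_irr.
  - by case: (fg i j).
  - by case: (fg j i).
  - by apply: contra_eq E => /adjg; apply: contraTneq => ->; rewrite adj_irr.
apply/existsP => -[f /andP[/injectiveP f_inj /forallP adjf]].
have adjE u v : @adj (B0 r) u v -> adj (f u) (f v).
  by have /forallP/(_ v)/implyP := adjf u; apply.
have := meet [set f (inl i) | i : 'I_r] [set f (inr i) | i : 'I_r].
case/(_ _ _)/set0Pn; try by apply: image_clique => i j ij; apply: adjE.
by move=> x; rewrite inE => /andP[/imsetP[i _ ->] /imsetP[j _ /f_inj]].
Qed.

End Copies.

(** * Clique counts of Turan graphs and of cones over them *)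

Definition turan_count (s m : nat) : nat :=
  \prod_(i < s) #|[set y : 'I_m | y %% s == i]|.

Lemma sum_residues s m : 0 < s -> \sum_(i < s) #|[set y : 'I_m | y %% s == i]| = m.
Proof.
move=> s0; rewrite -[RHS]card_ord -[RHS]cardsT.
rewrite -(@sum_fibers _ _ (fun y : 'I_m => y %% s) s); last by move=> y _; rewrite ltn_mod.
by apply: eq_bigr => i _; apply: eq_card => y; rewrite !inE.
Qed.

Lemma turan_count_ge s m : (m %/ s) ^ s <= turan_count s m.
Proof.
rewrite -[X in _ ^ X]card_ord -prod_nat_const leq_prod // => i _.
by rewrite card_residue // leq_addr.
Qed.

(** [prod_balanced] replaces Zykov's product by the Turan count. The condition [s <= m] makes this
    count positive, as the equality case of [zykov] requires. The labels obtained there have the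
    right part sizes only up to order, so they are permuted. *)
Lemma zykov_turan (G : sgraph) (A : {set G}) (s m : nat) :
  0 < s -> s <= m -> #|A| = m -> cliques A s.+1 = set0 ->
  #|cliques A s| <= turan_count s m /\
  (#|cliques A s| = turan_count s m ->
   exists p : G -> nat,
     [/\ {in A, forall x, p x < s},
         {in A &, forall x y, adj x y = (p x != p y)}
       & forall t, #|[set x in A | p x == t]| = #|[set y : 'I_m | y %% s == t]|]).
Proof.
move=> s0 sm cardA noK; have [p [lt_p le_p eq_p]] := zykov noK.
have q0 : 0 < m %/ s by rewrite divn_gt0.
pose a (i : 'I_s) := #|fiber A p i|.
pose b (i : 'I_s) := #|[set y : 'I_m | y %% s == i]|.
have sum_ab : \sum_i a i = \sum_i b i by rewrite sum_residues // -cardA -(sum_fibers lt_p).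
have bal_b : balanced (m %/ s) b := balanced_residue s m.
have opt := prod_balanced q0 bal_b sum_ab.
split=> [|eqK]; first exact: leq_trans le_p opt.1.
have posK : 0 < #|cliques A s|.
  by rewrite eqK (leq_trans _ (turan_count_ge s m)) // expn_gt0 q0.
have eq_ab : \prod_i a i = \prod_i b i.
  apply/eqP; rewrite eqn_leq opt.1 /= -/(turan_count s m) -eqK; exact: le_p.
have multi := eq_p (etrans eqK (esym eq_ab)) posK.
have bal_a : balanced (m %/ s) a by rewrite -opt.2 eq_ab.
have [h h_bij bh] := fiber_bijection (fun t => balanced_fibers t bal_a bal_b sum_ab).
(* The default [s] is reached only when [p x] is not below [s], which does not happen on [A]. *)
pose p' x : nat := oapp (fun i => nat_of_ord (h i)) s (insub (p x)).
have p'E x (xA : x \in A) : p' x = h (Ordinal (lt_p x xA)).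
  by rewrite /p' insubT /= ?lt_p // => lt; congr (nat_of_ord (h _)); apply: val_inj.
exists p'; split.
- by move=> x xA; rewrite p'E.
- move=> x y xA yA; rewrite multi // !p'E; congr (~~ _).
  by apply/eqP/eqP => [E|/val_inj/(bij_inj h_bij)[]//]; congr (nat_of_ord (h _)); apply: val_inj.
move=> t; have [lt_ts|le_st] := ltnP t s; last first.
  rewrite !eq_card0 // => x; rewrite !inE; apply/negP.
    by move=> /eqP E; have := ltn_mod x s; lia.
  by case/andP => xA; rewrite p'E => /eqP E; have := ltn_ord (h (Ordinal (lt_p x xA))); lia.
have [k hk kh] := h_bij; pose i := k (Ordinal lt_ts).
have hi : h i = Ordinal lt_ts by exact: kh.
have := bh i; rewrite hi /b /a /= => ->; apply: eq_card => x; rewrite !inE.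
case: (boolP (x \in A)) => //= xA; rewrite p'E.
apply/eqP/eqP => [E|E]; last by rewrite (_ : Ordinal _ = i) ?hi //; apply: val_inj.
by rewrite /i (_ : Ordinal lt_ts = h (Ordinal (lt_p x xA))) ?hk //; apply: val_inj.
Qed.

Lemma turan_multi s m : {in [set: turan s m] &, forall x y : turan s m,
  adj x y = ((x : 'I_m) %% s != (y : 'I_m) %% s)}.
Proof. by []. Qed.

(** The upper bound is [zykov_turan] applied to the Turan graph itself; the lower bound counts
    transversals of its parts. *)
Lemma copies_turan s m : 0 < s -> s <= m ->
  copies (complete s) (turan s m) = turan_count s m.
Proof.
move=> s0 sm; rewrite copies_complete; apply/eqP; rewrite eqn_leq; apply/andP; split.
  apply: (zykov_turan s0 sm _ _).1; first by rewrite cardsT card_ord.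
  apply/eqP; rewrite -subset0; apply/subsetP => S; rewrite inE => /and3P[SA cS /eqP cardS].
  have : #|S| <= s.
    by apply: (multipartite_clique_size (@turan_multi s m)) cS => // y _; rewrite ltn_mod.
  by rewrite cardS ltnn.
apply: leq_trans (prod_fibers_le_cliques s (@turan_multi s m)).
by apply: leq_prod => i _; apply/subset_leq_card/subsetP => x; rewrite !inE.
Qed.

(* [l] exhibits [G] as the complete [s.+1]-partite graph with the parts of
   [turan s m], labelled below [s], and one more part, a single vertex labelled
   [s]: that is, as [join (complete 1) (turan s m)]. *)
Definition cone_label (G : sgraph) (s m : nat) (l : G -> nat) : Prop :=
  (forall x y, adj x y = (l x != l y)) /\
  (forall t, #|[set x | l x == t]| =
     if t == s then 1 else #|[set y : 'I_m | y %% s == t]|).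

Lemma cone_label_join s m : 0 < s ->
  @cone_label (join (complete 1) (turan s m)) s m
    (fun u => match u with inl _ => s | inr y => (y : 'I_m) %% s end).
Proof.
move=> s0; split=> [[x|x] [y|y]|t] /=.
- by rewrite eqxx; apply/negbTE; rewrite /multipartite_adj negbK !ord1.
- by apply/esym; rewrite gtn_eqF // ltn_mod.
- by apply/esym; rewrite ltn_eqF // ltn_mod.
- by [].
case: eqP => [->|ts].
  rewrite -[RHS](cards1 (inl ord0 : join (complete 1) (turan s m))); apply: eq_card => -[x|x]; rewrite !inE.
    by rewrite ord1 !eqxx.
  by rewrite ltn_eqF // ltn_mod.
rewrite -(@card_imset _ _ (inr : 'I_m -> join (complete 1) (turan s m))); last by move=> x y [].
apply: eq_card => -[x|x]; rewrite !inE.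
  rewrite eq_sym; apply/eqP/imsetP => [/ts//|[y _]]; by [].
apply/idP/imsetP => [xt|[y yt [->]]]; last by rewrite inE in yt.
by exists x; rewrite ?inE.
Qed.

Lemma cone_label_isomorphic (G H : sgraph) s m (l : G -> nat) (k : H -> nat) :
  cone_label s m l -> cone_label s m k -> isomorphic G H.
Proof.
move=> [adjG fibG] [adjH fibH].
have [h h_bij kh] := fiber_bijection (fun t => etrans (fibG t) (esym (fibH t))).
by exists h => // x y; rewrite adjG adjH !kh.
Qed.

Lemma isomorphic_cone_label (G H : sgraph) s m (k : H -> nat) :
  isomorphic G H -> cone_label s m k -> exists l : G -> nat, cone_label s m l.
Proof.
move=> [f f_bij adjf] [adjH fibH]; exists (k \o f); split=> [x y|t].
  by rewrite -adjf adjH.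
rewrite -fibH -(on_card_preimset (onW_bij _ f_bij)).
by apply: eq_card => x; rewrite !inE.
Qed.

Section Cone.
Variables (G : sgraph) (s m : nat) (l : G -> nat).
Hypotheses (s0 : 0 < s) (cone : cone_label s m l).

(** The apex lies in every [s.+1]-clique: the other vertices carry only [s] labels, and a clique
    repeats none. *)
Lemma cone_free : free (B0 s.+1) G.
Proof.
have [adjG fibG] := cone.
have le_l x : l x <= s.
  rewrite leqNgt; apply/negP => lt; have := fibG (l x); rewrite gtn_eqF //.
  rewrite [RHS]eq_card0 => [/eqP|y].
    by rewrite cards_eq0 => /eqP/setP/(_ x); rewrite !inE eqxx.
  by rewrite !inE; apply/eqP => E; have := ltn_mod y s; lia.
have [v lv] : exists v, [set x | l x == s] = [set v].
  by apply/cards1P; rewrite fibG eqxx.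
have vin (S : {set G}) : S \in cliques setT s.+1 -> v \in S.
  rewrite inE => /and3P[_ cS /eqP cardS]; apply/negPn/negP => vS.
  suff : #|S| <= s by rewrite cardS ltnn.
  apply: (multipartite_clique_size (p := l) _ _ (subxx S)) cS => [x y _ _|x xS].
    exact: adjG.
  rewrite ltn_neqAle le_l andbT; apply: contraNneq vS => lx.
  by rewrite (_ : v = x) //; apply/esym/set1P; rewrite -lv inE lx.
by apply/free_B0P => S T SK TK; apply/set0Pn; exists v; rewrite inE !vin.
Qed.

Lemma cone_copies_ge : turan_count s m <= copies (complete s.+1) G.
Proof.
have [adjG fibG] := cone; rewrite copies_complete.
apply: leq_trans (@prod_fibers_le_cliques G setT l s.+1 _); last first.
  by move=> x y _ _; apply: adjG.
have fibE t : fiber setT l t = [set x | l x == t] by apply/setP => x; rewrite !inE.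
rewrite big_ord_recr /= fibE fibG eqxx muln1; apply: leq_prod => i _.
by rewrite fibE fibG ltn_eqF.
Qed.

End Cone.

Lemma common_vertex_bound (G : sgraph) (s m : nat) (v : G) :
  0 < s -> s <= m -> #|G| = m.+1 ->
  {in cliques [set: G] s.+1, forall S : {set G}, v \in S} ->
  copies (complete s.+1) G <= turan_count s m /\
  (copies (complete s.+1) G = turan_count s m ->
   exists l : G -> nat, cone_label s m l).
Proof.
move=> s0 sm cardG vin; rewrite copies_complete.
pose A := [set: G] :\ v.
have noK : cliques A s.+1 = set0.
  apply/eqP; rewrite -subset0; apply/subsetP => S SK.
  have vS := vin S (subsetP (sub_cliques _ (subsetT A)) S SK).
  move: SK; rewrite inE => /and3P[/subsetP/(_ v vS)].
  by rewrite !inE eqxx.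
have cardA : #|A| = m.
  by have := cardsD1 v [set: G]; rewrite cardsT cardG inE add1n => -[].
have [leT eqT] := zykov_turan s0 sm cardA noK.
have cardK : #|cliques [set: G] s.+1| = #|cliques (link setT v) s|.
  rewrite -card_cliques_at ?inE //; apply: eq_card => S; rewrite [RHS]inE.
  by apply/idP/andP => [SK|[]//]; rewrite vin.
have sub : cliques (link setT v) s \subset cliques A s.
  apply: sub_cliques; apply/subsetP => x; rewrite !inE andbT /=.
  by apply: contraTneq => ->; rewrite adj_irr.
have leK := subset_leq_card sub.
rewrite cardK; split=> [|eqK]; first exact: leq_trans leK leT.
(* The [s]-cliques in the link of [v] are among those of [A], whose number is at most the Turan
   count. Equality at the lower end therefore forces equality throughout. *)
have [p [lt_p multi fib]] : exists p : G -> nat,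
     [/\ {in A, forall x, p x < s},
         {in A &, forall x y, adj x y = (p x != p y)}
       & forall t, #|[set x in A | p x == t]| = #|[set y : 'I_m | y %% s == t]|].
  by apply: eqT; apply/eqP; rewrite eqn_leq leT -eqK leK.
have eq_link : cliques (link setT v) s = cliques A s.
  by apply/eqP; rewrite eqEcard sub eqK leT.
have inA x : (x \in A) = (x != v) by rewrite !inE andbT.
(* Every vertex of the Turan graph on [A] lies in an [s]-clique, and by [eq_link] that clique lies
   in the link of [v]. *)
have adjv x : x != v -> adj v x.
  rewrite -inA => xA; have [i|S SK xS] := clique_through multi xA lt_p.
    move=> lt; rewrite fib card_residue // addn_gt0 divn_gt0 ?sm //; exact: s0.
  by move: SK; rewrite -eq_link inE => /and3P[/subsetP/(_ x xS)]; rewrite inE => /andP[].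
exists (fun x => if x == v then s else p x); split=> [x y|t].
  have [->|xv] := eqVneq x v; have [->|yv] := eqVneq y v.
  - by rewrite adj_irr eqxx.
  - by rewrite adjv // gtn_eqF // lt_p // inA.
  - by rewrite adj_sym adjv // ltn_eqF // lt_p // inA.
  - by rewrite multi // inA.
case: eqP => [->|/eqP ts].
  rewrite -[RHS](cards1 v); apply: eq_card => x; rewrite !inE.
  by have [_|xv] := eqVneq x v; rewrite ?eqxx // ltn_eqF // lt_p // inA.
rewrite -fib; apply: eq_card => x; rewrite !inE andbT.
by have [_|//] := eqVneq x v; rewrite eq_sym (negPf ts).
Qed.

(** * Cliques without a common vertex, and the extremal number *)

Lemma bin_leq_exp n k : 'C(n, k) <= n ^ k.
Proof.
have le : n ^_ k <= n ^ k.
  elim: k => // k IH; rewrite ffactnSr expnSr; exact: leq_mul IH (leq_subr k n).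
by apply: leq_trans le; rewrite -bin_ffact leq_pmulr ?fact_gt0.
Qed.

(* Fix [S0] in [F], and for each [a] in [S0] a member [g a] of [F] avoiding [a].
   Every member of [F] contains some [a] in [S0] and some [b] in [g a]. *)
Lemma intersecting_bound (V : finType) (F : {set {set V}}) (r : nat) :
  {in F, forall S : {set V}, #|S| = r} ->
  {in F &, forall S T, S :&: T != set0} ->
  (forall v, exists2 S, S \in F & v \notin S) ->
  #|F| <= r ^ 2 * #|V| ^ (r - 2).
Proof.
move=> cardF meet avoid.
have [->|/set0Pn[S0 S0F]] := eqVneq F set0; first by rewrite cards0.
have [g gF notg] : exists2 g : V -> {set V}, forall v, g v \in F & forall v, v \notin g v.
  exact: (@fin_all_exists2 V (fun=> {set V}) (fun v S => S \in F) (fun v S => v \notin S)).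
pose K a b := [set S in F | (a \in S) && (b \in S)].
have cardK a b : a != b -> #|K a b| <= #|V| ^ (r - 2).
  move=> ab; apply: leq_trans (bin_leq_exp _ _); rewrite -card_draws.
  rewrite -(@card_in_imset _ _ (fun S : {set V} => S :\ a :\ b) (mem (K a b))).
    apply/subset_leq_card/subsetP => _ /imsetP[S SK ->]; rewrite inE.
    move: SK; rewrite inE => /and3P[/cardF <- aS bS].
    by rewrite (cardsD1 a S) aS (cardsD1 b (S :\ a)) !inE (eq_sym b) ab bS /= !add1n subn2.
  move=> S T; rewrite !inE => /and3P[_ aS bS] /and3P[_ aT bT] E.
  have bS' : b \in S :\ a by rewrite !inE (eq_sym b) ab.
  have bT' : b \in T :\ a by rewrite !inE (eq_sym b) ab.
  have E' : S :\ a = T :\ a by rewrite -(setD1K bS') E setD1K.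
  by rewrite -(setD1K aS) E' setD1K.
have cover : F \subset \bigcup_(a in S0) \bigcup_(b in g a) K a b.
  apply/subsetP => S SF.
  have /set0Pn[a /setIP[aS aS0]] := meet S S0 SF S0F.
  have /set0Pn[b /setIP[bS bg]] := meet S (g a) SF (gF a).
  by apply/bigcupP; exists a => //; apply/bigcupP; exists b; rewrite // inE SF aS.
apply: leq_trans (subset_leq_card cover) _.
have le_big (I : finType) (P : {set I}) (f : I -> {set {set V}}) c :
    {in P, forall i, #|f i| <= c} -> #|\bigcup_(i in P) f i| <= #|P| * c.
  move=> le; rewrite -sum_nat_const; apply: (big_ind2 (fun (S : {set {set V}}) n => #|S| <= n)).
  - by rewrite cards0.
  - by move=> S1 n1 S2 n2 h1 h2; exact: leq_trans (leq_card_setU _ _) (leq_add h1 h2).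
  - exact: le.
rewrite expnS expn1 -mulnA -{1}(cardF S0 S0F); apply: (le_big V) => a aS0.
rewrite -(cardF _ (gF a)); apply: (le_big V) => b bg; rewrite (cardF _ (gF a)).
(* [b] lies in [g a], which avoids [a]; so two distinct vertices are prescribed, leaving [r - 2]
   free ones. *)
by apply: cardK; apply: contraNneq (notg a) => {1}->.
Qed.

(** Let [q = m %/ s] and [C = s.+1 ^ 2 * (2 * s) ^ s.-1]. The threshold says [C < q], and
    [m.+1 <= q * (2 * s)], so the left side is at most [C * q ^ s.-1 < q ^ s]. *)
Lemma turan_count_large s m : 1 < s -> s * (s.+1 ^ 2 * (2 * s) ^ s.-1).+1 <= m ->
  s.+1 ^ 2 * m.+1 ^ s.-1 < turan_count s m.
Proof.
move=> s1 large; apply: leq_trans (turan_count_ge s m).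
set C := s.+1 ^ 2 * _ in large.
have s0 : 0 < s by exact: ltnW.
have qC : C < m %/ s by rewrite leq_divRL // mulnC.
set q := m %/ s in qC *.
have le_m : m.+1 <= q * (2 * s).
  have := ltn_ceil m s0; rewrite -/q => lt.
  have : q.+1 * s <= q * (2 * s) by rewrite mulnA leq_mul2r; lia.
  lia.
apply: (@leq_ltn_trans (C * q ^ s.-1)).
  rewrite /C -mulnA -expnMn leq_mul2l leq_exp2r ?(mulnC _ q) ?le_m ?orbT //; lia.
by rewrite -[X in _ < _ ^ X](prednK s0) expnS ltn_mul2r qC expn_gt0 (leq_ltn_trans _ qC).
Qed.

Lemma copies_bound (G : sgraph) (s m : nat) :
  1 < s -> s * (s.+1 ^ 2 * (2 * s) ^ s.-1).+1 <= m ->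
  #|G| = m.+1 -> free (B0 s.+1) G ->
  copies (complete s.+1) G <= turan_count s m /\
  (copies (complete s.+1) G = turan_count s m ->
   exists l : G -> nat, cone_label s m l).
Proof.
move=> s1 large cardG /free_B0P meet.
have s0 : 0 < s by exact: ltnW.
have sm : s <= m by apply: leq_trans large; rewrite leq_pmulr.
have [/existsP[v /forall_inP vin]|] :=
    boolP [exists v, forall S in cliques [set: G] s.+1, v \in S].
  exact: common_vertex_bound vin.
rewrite negb_exists => /forallP none.
have lt : copies (complete s.+1) G < turan_count s m.
  apply: leq_ltn_trans (turan_count_large s1 large).
  rewrite copies_complete -cardG -subn1 -subSS.
  apply: intersecting_bound => [S|//|v]; first by rewrite inE => /and3P[_ _ /eqP].
  by have := none v; rewrite negb_forall_in => /exists_inP.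
by split; [exact: ltnW | move=> E; rewrite E ltnn in lt].
Qed.

(** [ex_copies] ranges over edge sets on ['I_n], so the extremal join has to be transported there to
    serve as a witness. *)
Lemma graph_of_edges_onto (G : sgraph) n : #|G| = n ->
  exists E : {set {set 'I_n}}, isomorphic (graph_of_edges E) G.
Proof.
move=> cardG; pose f (i : 'I_n) : G := enum_val (cast_ord (esym cardG) i).
have f_inj : injective f by move=> i j /enum_val_inj/cast_ord_inj.
have f_bij : bijective f by apply: inj_card_bij; rewrite ?cardG ?card_ord.
exists [set e : {set 'I_n} | [exists x, exists y, adj (f x) (f y) && (e == [set x; y])]].
exists f => // x y; rewrite /= /edges_adj inE; apply/esym.
apply/andP/idP => [[xy /existsP[i /existsP[j /andP[ij /eqP E]]]]|xy]; last first.
  split; last by apply/existsP; exists x; apply/existsP; exists y; rewrite xy eqxx.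
  by apply: contraTneq xy => ->; rewrite adj_irr.
have : i \in [set x; y] by rewrite E set21.
have : j \in [set x; y] by rewrite E set22.
rewrite !inE => /orP[]/eqP Ej /orP[]/eqP Ei; subst i j; move: ij => //.
- by rewrite adj_irr.
- by rewrite adj_sym.
- by rewrite adj_irr.
Qed.

Theorem theorem1p5 (r : nat) (hr : 3 <= r) :
  exists n0 : nat, forall n : nat, n0 <= n ->
    ex_copies n (complete r) (B0 r) = copies (complete r.-1) (turan r.-1 n.-1) /\
    forall G : sgraph,
      [/\ #|G| = n, free (B0 r) G
        & copies (complete r) G = ex_copies n (complete r) (B0 r)]
      <-> isomorphic G (join (complete 1) (turan r.-1 n.-1)).
Proof.
case: r hr => // s s1; rewrite [s.+1.-1]/=.
(* The threshold of [turan_count_large], shifted by one because [n = m.+1] counts the apex as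
   well. *)
exists (s * (s.+1 ^ 2 * (2 * s) ^ s.-1).+1).+1 => -[//|m large].
rewrite ltnS in large; rewrite [m.+1.-1]/=.
have s0 : 0 < s by exact: ltnW.
have sm : s <= m by apply: leq_trans large; rewrite leq_pmulr.
have bound (G : sgraph) := @copies_bound G s m s1 large.
pose J := join (complete 1) (turan s m).
have coneJ := cone_label_join m s0.
have cardJ : #|J| = m.+1 by rewrite card_sum !card_ord.
(* The lower bound comes from transversals; the upper bound holds because a cone is itself
   [B0 s.+1]-free. *)
have cone_copies (G : sgraph) (l : G -> nat) : #|G| = m.+1 -> cone_label s m l ->
    copies (complete s.+1) G = turan_count s m.
  move=> cardG cone; apply/eqP; rewrite eqn_leq (cone_copies_ge cone) andbT.
  by have [] := bound G cardG (cone_free s0 cone).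
have exE : ex_copies m.+1 (complete s.+1) (B0 s.+1) = turan_count s m.
  apply/eqP; rewrite eqn_leq; apply/andP; split.
    apply/bigmax_leqP => E freeE.
    by have [] := bound (graph_of_edges E) (card_ord _) freeE.
  have [E isoE] := graph_of_edges_onto cardJ.
  have [l coneE] := isomorphic_cone_label isoE coneJ.
  rewrite -(cone_copies (graph_of_edges E) l (card_ord _) coneE).
  apply: (leq_bigmax_cond E); exact: cone_free coneE.
rewrite exE copies_turan //; split=> // G; split=> [[cardG freeG eqG]|isoG].
  have [l coneG] := (bound G cardG freeG).2 eqG.
  exact: cone_label_isomorphic coneG coneJ.
have [l coneG] := isomorphic_cone_label isoG coneJ.
have cardG : #|G| = m.+1.
  by case: isoG => f f_bij _; rewrite -cardJ; apply: bij_eq_card f_bij.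
by split; [|exact: cone_free coneG|exact: cone_copies coneG].
Qed.
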